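(* Let $\{X_k\}_{k\ge1}$, $X_k\subset X_{k+1}\subset X$, be a nested sequence of Banach spaces. Let $u\in X$, and let $\{u_k\}_{k\ge1}$, $u_k\in X_k$, be a sequence of approximations to $u$, with error indicator values $\eta_k=\eta_k(u_k)$, where $\eta_k:X_k\to\mathbb{R}$, and with $e_k=\|u-u_k\|_X$, $E_k=\|u_{k+1}-u_k\|_X$. Assume that, with the same constants $\Lambda\ge1$, $C_1>0$, $C_2>0$, $\omega\in(0,1)$ for every $k$: (Quasi-orthogonality) $e_{k+1}^2\le\Lambda e_k^2-E_k^2$; (Upper bound) $e_k^2\le C_1\eta_k^2$; (Indicator reduction) $\eta_{k+1}^2\le C_2E_k^2+(1-\omega)\eta_k^2$. Let $\beta\in(0,1)$, $1\le\Lambda<1+\frac{\beta\omega}{C_1C_2}$, let $\gamma$ satisfy $$\frac{(\Lambda-1)C_1}{\beta\omega}<\gamma<\min\left\{\frac1{C_2},\frac{\Lambda C_1}{\beta\omega}\right\},$$ and let $\alpha\in(0,1)$ be given by $\alpha^2=\max\left\{\Lambda-\frac{\beta\omega\gamma}{C_1},\ 1-[1-\beta]\omega\right\}$. Then the sequence $\{u_k\}$ contracts toward $u$ according to $$e_{k+1}^2+\gamma\eta_{k+1}^2\le\alpha^2\left(e_k^2+\gamma\eta_k^2\right),$$ and therefore converges to $u$ at the rate $$e_k^2+\gamma\eta_k^2\le C\alpha^{2k},$$ for some constant $C=C(u_1,\eta_1,\Lambda,C_1,C_2,\alpha,\beta,\gamma,\omega)$.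
   Context: $\|\cdot\|_X$ denotes a norm on $X$, either the native Banach norm or more generally a norm associated with a problem-specific bilinear form. *)

(* Defs.v *)
From HB Require Import structures.
From mathcomp Require Import all_boot all_order all_algebra.
From mathcomp Require Import all_classical all_reals all_analysis.

Set Implicit Arguments.
Unset Strict Implicit.
Unset Printing Implicit Defensive.

Import Order.TTheory GRing.Theory Num.Theory.
Import numFieldNormedType.Exports.

Local Open Scope classical_set_scope.
Local Open Scope ring_scope.

(* A norm on the vector space X, not necessarily the native norm [`|x|] of X:
   it may for instance be an energy norm induced by a bilinear form.
   Nonnegativity follows from the first two clauses. *)
Definition is_norm (R : realType) (X : lmodType R) (N : X -> R) : Prop :=
  [/\ forall x y : X, N (x + y) <= N x + N y,
      forall (a : R) (x : X), N (a *: x) = `|a| * N x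
    & forall x : X, N x = 0 -> x = 0].

(* The inclusions X_k \subset X_{k+1} \subset X, for k >= 1, of linear
   subspaces: each Banach space X_k is its own type, identified with a subspace
   of X by the injective linear map [emb k].  X_k carries its own complete norm,
   which may but need not be the restriction of the norm of X.
   The index k = 0 is unused. *)
Definition nested_subspaces (R : realType) (X : lmodType R)
    (Xk : nat -> completeNormedModType R)
    (emb : forall k, {linear Xk k -> X}) : Prop :=
  forall k, (0 < k)%N ->
    injective (emb k) /\ range (emb k) `<=` range (emb k.+1).

(* Main.v *)
Require Import Defs.
From HB Require Import structures.
From mathcomp Require Import all_boot all_order all_algebra.
From mathcomp Require Import all_classical all_reals all_analysis.
From mathcomp Require Import lra.

(** Adding [gamma] times the indicator reduction to the quasi-orthogonality
    bound gives
      [e'^2 + gamma eta'^2 <= Lambda e^2 + (gamma C2 - 1) E^2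
                              + gamma (1 - omega) eta^2],
    and [gamma < 1 / C2] lets the [- E^2] of quasi-orthogonality absorb the
    increment.  What is left does not contract as it stands, since
    [Lambda >= 1]; but the indicator term has a whole [gamma omega eta^2]
    to spare.  Spending the fraction [beta] of it on the error through the upper
    bound [e^2 <= C1 eta^2] leaves
      [(Lambda - beta omega gamma / C1) e^2
         + gamma (1 - (1 - beta) omega) eta^2],
    which is the contraction with [alpha^2] the larger coefficient
    ([total_error_step]).  The lower bound on [gamma] says exactly that the
    first coefficient is below 1 ([contraction_factor_bounds]).

    Iterating from [k = 1] gives the factor [alpha^(2 (k - 1))] times the
    initial total error, and by the upper bound this initial error is at most
    [(C1 + gamma) eta_1^2].  Hence [C = (C1 + gamma) eta_1^2 / alpha^2], which
    involves neither [u] nor the spaces.  Convergence of [e] follows by taking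
    square roots and squeezing. *)

Import Order.TTheory GRing.Theory Num.Theory.
Import numFieldNormedType.Exports.

Local Open Scope classical_set_scope.
Local Open Scope ring_scope.

Lemma is_norm_ge0 (R : realType) (X : lmodType R) (N : X -> R) (x : X) :
  is_norm N -> 0 <= N x.
Proof.
case=> triangle homog _.
have N0 : N 0 = 0 by rewrite -(scale0r x) homog normr0 mul0r.
have NN : N (- x) = N x by rewrite -scaleN1r homog normrN1 mul1r.
by have := triangle x (- x); rewrite subrr N0 NN; lra.
Qed.

Section scalar_estimates.
Context {R : realType}.

(** The arguments stand for the squares of the errors, of the increment and of
    the indicators, in which all three assumptions are linear. *)
Lemma total_error_step (Lambda C1 C2 omega beta gamma r : R)
    (e2 e2' E2 eta2 eta2' : R) :
  0 < C1 -> 0 < beta * omega -> 0 < gamma -> gamma * C2 <= 1 ->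
  0 <= e2 -> 0 <= E2 -> 0 <= eta2 ->
  e2' <= Lambda * e2 - E2 ->
  e2 <= C1 * eta2 ->
  eta2' <= C2 * E2 + (1 - omega) * eta2 ->
  Lambda - beta * omega * gamma / C1 <= r ->
  1 - (1 - beta) * omega <= r ->
  e2' + gamma * eta2' <= r * (e2 + gamma * eta2).
Proof.
move=> C1_gt0 bo_gt0 g_gt0 gC2 e_ge0 E_ge0 eta_ge0 quasi_orth upper reduction
  le_r1 le_r2.
have reduction_g := ler_wpM2l (ltW g_gt0) reduction.
have increment := ler_wpM2r E_ge0 gC2.
have transfer : beta * omega * gamma / C1 * e2 <= beta * omega * gamma * eta2.
  rewrite -[leLHS]mulrA; apply: ler_wpM2l.
    exact: ltW (mulr_gt0 bo_gt0 g_gt0).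
  by rewrite mulrC ler_pdivrMr // mulrC.
have error_part := ler_wpM2r e_ge0 le_r1.
have indicator_part := ler_wpM2r (mulr_ge0 (ltW g_gt0) eta_ge0) le_r2.
lra.
Qed.

(** Positivity comes from the second entry alone, so that the maximum has a
    square root even if the first entry is negative. *)
Lemma contraction_factor_bounds (Lambda C1 omega beta gamma : R) :
  0 < C1 -> 0 < omega < 1 -> 0 < beta < 1 ->
  (Lambda - 1) * C1 / (beta * omega) < gamma ->
  0 < Num.max (Lambda - beta * omega * gamma / C1) (1 - (1 - beta) * omega) < 1.
Proof.
move=> C1_gt0 /andP[omega_gt0 omega_lt1] /andP[beta_gt0 beta_lt1].
rewrite ltr_pdivrMr ?mulr_gt0 // => lower.
have c_gt0 : 0 < (1 - beta) * omega by rewrite mulr_gt0 // subr_gt0.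
have c_lt1 : (1 - beta) * omega < 1 by nra.
rewrite lt_max gt_max [_ < 1 - (1 - beta) * omega]subr_gt0 c_lt1 orbT /=.
apply/andP; split; last by lra.
suff: Lambda - 1 < beta * omega * gamma / C1 by move=> ?; lra.
by rewrite ltr_pdivlMr // [beta * omega * gamma]mulrC.
Qed.

(** The division by [r] accounts for the recurrence starting at [k = 1]. *)
Lemma geometric_decay (a : nat -> R) (r K : R) :
  0 < r -> a 1%N <= K ->
  (forall k, (0 < k)%N -> a k.+1 <= r * a k) ->
  forall k, (0 < k)%N -> a k <= K / r * r ^+ k.
Proof.
move=> r_gt0 a1 step; elim=> // -[_ _|k IHk _].
  by rewrite expr1 mulfVK ?gt_eqF.
apply: (le_trans (step k.+1 isT)).
rewrite [r ^+ k.+2]exprS mulrCA.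
by apply: ler_wpM2l; [exact: ltW | exact: IHk].
Qed.

Lemma cvg0_of_sqr_geometric_bound (e : nat -> R) (K s : R) :
  0 < s < 1 -> 0 <= K -> (forall k, 0 <= e k) ->
  (forall k, (0 < k)%N -> e k ^+ 2 <= K * s ^+ (2 * k)) ->
  e @ \oo --> (0 : R).
Proof.
move=> /andP[s_gt0 s_lt1] K_ge0 e_ge0 bound.
apply: (@squeeze_cvgr _ _ _ _ (cst 0) (geometric (Num.sqrt K) s)).
- exists 1%N => // k /= k_gt0; rewrite e_ge0 /=.
  have rhs_ge0 : 0 <= Num.sqrt K * s ^+ k.
    by rewrite mulr_ge0 ?sqrtr_ge0 ?exprn_ge0 ?ltW.
  rewrite -ler_sqr ?nnegrE // exprMn sqr_sqrtr // -exprM mulnC.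
  exact: bound.
- exact: cvg_cst.
- by apply: cvg_geometric; rewrite ger0_norm ?ltW.
Qed.

End scalar_estimates.

Theorem theorem6p10 (R : realType) (X : completeNormedModType R)
    (norm_X : X -> R) (norm_XP : is_norm norm_X) :
  (* C u_1 eta_1 Lambda C1 C2 alpha beta gamma omega *)
  exists C : X -> R -> R -> R -> R -> R -> R -> R -> R -> R,
  forall (Xk : nat -> completeNormedModType R)
    (emb : forall k, {linear Xk k -> X})
    (u : X) (u_ : forall k, Xk k) (eta : forall k, Xk k -> R)
    (Lambda C1 C2 omega beta gamma : R),
  let e := fun k : nat => norm_X (u - emb k (u_ k)) in
  let E := fun k : nat => norm_X (emb k.+1 (u_ k.+1) - emb k (u_ k)) in
  let eta_ := fun k : nat => eta k (u_ k) in
  let alpha_sq := Num.max (Lambda - beta * omega * gamma / C1)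
                          (1 - (1 - beta) * omega) in
  nested_subspaces emb ->
  1 <= Lambda -> 0 < C1 -> 0 < C2 -> 0 < omega < 1 ->
  (forall k, (0 < k)%N -> e k.+1 ^+ 2 <= Lambda * e k ^+ 2 - E k ^+ 2) ->
  (forall k, (0 < k)%N -> e k ^+ 2 <= C1 * eta_ k ^+ 2) ->
  (forall k, (0 < k)%N ->
     eta_ k.+1 ^+ 2 <= C2 * E k ^+ 2 + (1 - omega) * eta_ k ^+ 2) ->
  0 < beta < 1 ->
  Lambda < 1 + beta * omega / (C1 * C2) ->
  (Lambda - 1) * C1 / (beta * omega) < gamma ->
  gamma < Num.min (1 / C2) (Lambda * C1 / (beta * omega)) ->
  (exists2 alpha : R, 0 < alpha < 1 & alpha ^+ 2 = alpha_sq) /\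
  (forall alpha : R, 0 < alpha < 1 -> alpha ^+ 2 = alpha_sq ->
     [/\ forall k, (0 < k)%N ->
           e k.+1 ^+ 2 + gamma * eta_ k.+1 ^+ 2
             <= alpha ^+ 2 * (e k ^+ 2 + gamma * eta_ k ^+ 2),
         e @ \oo --> (0 : R)
       & forall k, (0 < k)%N ->
           e k ^+ 2 + gamma * eta_ k ^+ 2
             <= C (emb 1%N (u_ 1%N)) (eta_ 1%N) Lambda C1 C2
                  alpha beta gamma omega * alpha ^+ (2 * k)]).
Proof.
exists (fun _ eta1 _ C1 _ alpha _ gamma _ =>
  (C1 + gamma) * eta1 ^+ 2 / alpha ^+ 2).
move=> Xk emb u u_ eta Lambda C1 C2 omega beta gamma e E eta_ alpha_sq.
move=> _ L_ge1 C1_gt0 C2_gt0 o01 quasi_orth upper reduction b01 _ g_lower.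
rewrite lt_min => /andP[g_upper _].
have /andP[a2_gt0 a2_lt1] : 0 < alpha_sq < 1.
  exact: contraction_factor_bounds.
have bo_gt0 : 0 < beta * omega.
  by case/andP: o01 => omega_gt0 _; case/andP: b01 => *; exact: mulr_gt0.
have g_gt0 : 0 < gamma.
  apply: le_lt_trans g_lower.
  by rewrite divr_ge0 ?(ltW bo_gt0) // mulr_ge0 ?subr_ge0 // ltW.
have gC2 : gamma * C2 <= 1 by rewrite -ler_pdivlMr // ltW.
split.
  exists (Num.sqrt alpha_sq); last by rewrite sqr_sqrtr // ltW.
  by rewrite sqrtr_gt0 a2_gt0 -sqrtr1 ltr_sqrt.
move=> alpha a01 alphaE; have /andP[a_gt0 _] := a01.
have contraction k : (0 < k)%N ->
    e k.+1 ^+ 2 + gamma * eta_ k.+1 ^+ 2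
      <= alpha ^+ 2 * (e k ^+ 2 + gamma * eta_ k ^+ 2).
  move=> k_gt0; rewrite alphaE.
  apply: (@total_error_step R Lambda C1 C2 omega beta gamma _ _ _ (E k ^+ 2));
    rewrite ?sqr_ge0 ?le_max ?lexx ?orbT //.
  - exact: quasi_orth.
  - exact: upper.
  - exact: reduction.
have rate k : (0 < k)%N ->
    e k ^+ 2 + gamma * eta_ k ^+ 2
      <= (C1 + gamma) * eta_ 1%N ^+ 2 / alpha ^+ 2 * alpha ^+ (2 * k).
  rewrite exprM; apply: (@geometric_decay R
    (fun k => e k ^+ 2 + gamma * eta_ k ^+ 2)) => //.
    exact: exprn_gt0.
  by rewrite mulrDl lerD2r; exact: upper.
split => //.
apply: (@cvg0_of_sqr_geometric_bound R e
  ((C1 + gamma) * eta_ 1%N ^+ 2 / alpha ^+ 2) alpha) => //.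
- by rewrite divr_ge0 ?sqr_ge0 // mulr_ge0 ?sqr_ge0 // addr_ge0 // ltW.
- by move=> k; exact: is_norm_ge0.
- move=> k k_gt0; apply: le_trans (rate k k_gt0).
  by rewrite lerDl mulr_ge0 ?sqr_ge0 // ltW.
Qed.
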